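(* Let $R$ be a commutative ring with unit and let $A$ be an associative unital $R$-algebra. Then $A$ admits a nearly Frobenius structure $\Delta: A\to A\otimes_R A$ whose handle element $\omega_{A,\Delta}=m(\Delta(1))$ is a unit of $A$ if and only if $A$ is separable over $R$.
   Context: A nearly Frobenius structure on an associative unital $R$-algebra $A$ is a homomorphism of $A$-bimodules $\Delta: A\to A\otimes_R A$, where $A\otimes_R A$ has the bimodule structure $a\cdot(x\otimes y)\cdot b=ax\otimes yb$. Writing $m:A\otimes_R A\to A$ for the multiplication, the handle element of $(A,\Delta)$ is $\omega_{A,\Delta}=m(\Delta(1))\in A$. The algebra $A$ is separable over $R$ if there exists $e\in A\otimes_R A$ with $m(e)=1$ and $x\cdot e=e\cdot x$ for all $x\in A$. *)

(* Defs.v *)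
From HB Require Import structures.
From mathcomp Require Import all_boot all_algebra boolp freeg.

Set Implicit Arguments.
Unset Strict Implicit.
Unset Printing Implicit Defensive.

Import GRing.Theory.
Local Open Scope ring_scope.
Local Open Scope quotient_scope.

(* MathComp's algType requires 1 != 0; dropping that axiom admits the zero
   algebra.  The other axioms are those of algType (see algebra_of_algType). *)
Record algebra (R : pzRingType) := Algebra {
  alg_ring : pzRingType;
  alg_scale : R -> alg_ring -> alg_ring;
  alg_scaleA : forall r s x,
    alg_scale r (alg_scale s x) = alg_scale (r * s) x;
  alg_scale1 : left_id 1 alg_scale;
  alg_scaleDr : right_distributive alg_scale +%R;
  alg_scaleDl : forall x, {morph alg_scale^~ x : r s / r + s};
  alg_scaleAl : forall r x y, alg_scale r (x * y) = alg_scale r x * y;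
  alg_scaleAr : forall r x y, alg_scale r (x * y) = x * alg_scale r y
}.

Definition alg_sort (R : pzRingType) (A : algebra R) : Type := alg_ring A.
Coercion alg_sort : algebra >-> Sortclass.

HB.instance Definition _ (R : pzRingType) (A : algebra R) :=
  GRing.PzRing.copy (alg_sort A) (alg_ring A).
HB.instance Definition _ (R : pzRingType) (A : algebra R) :=
  GRing.Zmodule_isLmodule.Build R (alg_sort A) (@alg_scaleA R A)
    (@alg_scale1 R A) (@alg_scaleDr R A) (@alg_scaleDl R A).

Lemma algebra_scalerAl (R : pzRingType) (A : algebra R) (r : R) (x y : A) :
  r *: (x * y) = (r *: x) * y.
Proof. exact: alg_scaleAl. Qed.

Lemma algebra_scalerAr (R : pzRingType) (A : algebra R) (r : R) (x y : A) :
  r *: (x * y) = x * (r *: y).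
Proof. exact: alg_scaleAr. Qed.

Definition algebra_of_algType (R : pzRingType) (A : algType R) : algebra R :=
  @Algebra R A *:%R (@scalerA R A) (@scale1r R A) (@scalerDr R A)
    (fun x r s => scalerDl x r s) (@scalerAl R A) (@scalerAr R A).

(* The tensor product of two R-modules: the free abelian group on U * V modulo
   the subgroup generated by the relations of biadditivity and R-balancedness. *)
Section Tensor.
Variables (R : comPzRingType) (U V : lmodType R).
Local Notation free := {freeg (U * V)%type / int}.

Inductive tensor_rel : free -> Prop :=
| tensor_rel0 : tensor_rel 0
| tensor_relB x y : tensor_rel x -> tensor_rel y -> tensor_rel (x - y)
| tensor_relDl u u' v :
    tensor_rel (<< (u + u', v) >> - << (u, v) >> - << (u', v) >>)
| tensor_relDr u v v' :
    tensor_rel (<< (u, v + v') >> - << (u, v) >> - << (u, v') >>)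
| tensor_relZ r u v :
    tensor_rel (<< (r *: u, v) >> - << (u, r *: v) >>).

Definition tensor_pred (x : free) : bool :=
  `[< tensor_rel x >].

Lemma tensor_pred_zmod_closed : zmod_closed tensor_pred.
Proof.
split=> [|x y /asboolP hx /asboolP hy]; apply/asboolP; first exact: tensor_rel0.
exact: tensor_relB.
Qed.

HB.instance Definition _ :=
  GRing.isZmodClosed.Build free tensor_pred
    tensor_pred_zmod_closed.

Definition tensor_sub : zmodClosed free :=
  GRing.ZmodClosed.clone free tensor_pred _.
Definition tensor : Type := Quotient.quot tensor_sub.
HB.instance Definition _ := EqQuotient.on tensor.
HB.instance Definition _ := GRing.Zmodule.on tensor.

Definition tens (u : U) (v : V) : tensor := \pi_tensor << (u, v) >>.

Lemma tensor_rel_eq x y : tensor_rel (x - y) ->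
  \pi_tensor x = \pi_tensor y.
Proof. by move=> h; apply/eqP; rewrite -Quotient.idealrBE; apply/asboolP. Qed.

Lemma tensDl u u' v : tens (u + u') v = tens u v + tens u' v.
Proof.
rewrite /tens -[RHS]raddfD; apply: tensor_rel_eq; rewrite opprD addrA.
exact: tensor_relDl.
Qed.

Lemma tensDr u v v' : tens u (v + v') = tens u v + tens u v'.
Proof.
rewrite /tens -[RHS]raddfD; apply: tensor_rel_eq; rewrite opprD addrA.
exact: tensor_relDr.
Qed.

Lemma tensZC r u v : tens (r *: u) v = tens u (r *: v).
Proof. exact/tensor_rel_eq/tensor_relZ. Qed.

Lemma tensor_ind (P : tensor -> Prop) :
  (forall u v, P (tens u v)) -> (forall x y, P x -> P y -> P (x - y)) ->
  forall x, P x.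
Proof.
move=> Pt PB; have P0 : P 0 by rewrite -(subrr (tens 0 0)); apply: PB.
have PN x : P x -> P (- x) by rewrite -[- x]add0r; apply: PB.
have PD x y : P x -> P y -> P (x + y).
  by move=> Px Py; rewrite -[y]opprK; apply/PB/PN.
have PMn x n : P x -> P (x *+ n).
  by move=> Px; elim: n => [|n IHn]; rewrite ?mulr0n // mulrS; apply: PD.
move=> x; rewrite -[x]reprK -(freeg_sumE (repr x)) raddf_sum.
elim/big_rec: _ => // -[u v] y _; apply: PD.
case: (coeff _ _) => n.
  by rewrite -[Posz n]natz -freegU_muln raddfMn; apply/PMn/Pt.
by rewrite NegzE -freegUN -[Posz n.+1]natz -freegU_muln raddfN raddfMn;
   apply/PN/PMn/Pt.
Qed.

(* The additive map u (x) v |-> f u v; meaningful when f is biadditive and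
   balanced, see tensor_lift_additive and tensor_liftE. *)
Definition tensor_lift (W : zmodType) (f : U -> V -> W) (x : tensor) : W :=
  fglift (fun p => f p.1 p.2 : zmodule W) (repr x).

Section Lift.
Variables (W : zmodType) (f : U -> V -> W).
Hypothesis fDl : forall u u' v, f (u + u') v = f u v + f u' v.
Hypothesis fDr : forall u v v', f u (v + v') = f u v + f u v'.
Hypothesis fZC : forall r u v, f (r *: u) v = f u (r *: v).

Let F : free -> zmodule W := fglift (fun p => f p.1 p.2 : zmodule W).

Let FB x y : F (x - y) = F x - F y.
Proof. exact: lift_is_additive. Qed.

Let FU u v : F << (u, v) >> = f u v.
Proof. by rewrite /F liftU scale1r. Qed.

Let F_rel x : tensor_rel x -> F x = 0.
Proof.
elim=> {x} [|x y _ hx _ hy|u u' v|u v v'|r u v]; rewrite ?FB ?FU.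
- by rewrite -(subrr 0) FB subrr.
- by rewrite hx hy subrr.
- by rewrite fDl addrAC addrK subrr.
- by rewrite fDr addrAC addrK subrr.
- by rewrite fZC subrr.
Qed.

Let F_pi x : tensor_lift f (\pi_tensor x) = F x.
Proof.
apply/eqP; rewrite -subr_eq0 -[_ - _]FB; apply/eqP/F_rel/asboolP.
by rewrite -[`[< _ >]]/(_ \in tensor_pred) Quotient.idealrBE reprK.
Qed.

Lemma tensor_lift_additive : zmod_morphism (tensor_lift f).
Proof.
move=> x y; rewrite -[x]reprK -[y]reprK -raddfB /=.
by rewrite !F_pi FB.
Qed.

Lemma tensor_liftE u v : tensor_lift f (tens u v) = f u v.
Proof. by rewrite F_pi FU. Qed.

Lemma tensor_lift_uniq (g : tensor -> W) : zmod_morphism g ->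
  (forall u v, g (tens u v) = f u v) -> g =1 tensor_lift f.
Proof.
move=> gB gE; apply: tensor_ind => [u v|x y gx gy].
  by rewrite gE tensor_liftE.
by rewrite gB gx gy tensor_lift_additive.
Qed.

End Lift.

Lemma tensor_ext (W : zmodType) (g h : tensor -> W) :
  zmod_morphism g -> zmod_morphism h ->
  (forall u v, g (tens u v) = h (tens u v)) -> g =1 h.
Proof.
by move=> gB hB E; apply: tensor_ind => // x y; rewrite gB hB => -> ->.
Qed.

Definition tensor_scale (r : R) : tensor -> tensor :=
  tensor_lift (fun u v => tens (r *: u) v).

Lemma tensor_scale_additive r : zmod_morphism (tensor_scale r).
Proof.
apply: tensor_lift_additive => [u u' v|u v v'|s u v].
- by rewrite scalerDr tensDl.
- exact: tensDr.
- by rewrite -tensZC !scalerA mulrC.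
Qed.

Lemma tensor_scaleE r u v : tensor_scale r (tens u v) = tens (r *: u) v.
Proof.
apply: (tensor_liftE (f := fun u v => tens (r *: u) v))
  => [{}u u' {}v|{}u {}v v'|s {}u {}v].
- by rewrite scalerDr tensDl.
- exact: tensDr.
- by rewrite -tensZC !scalerA mulrC.
Qed.

Lemma tensor_scaleA r s x :
  tensor_scale r (tensor_scale s x) = tensor_scale (r * s) x.
Proof.
move: x; apply: tensor_ind => [u v|x y hx hy].
  by rewrite !tensor_scaleE scalerA.
by rewrite !tensor_scale_additive hx hy.
Qed.

Lemma tensor_scale1 : left_id 1 tensor_scale.
Proof.
apply: tensor_ind => [u v|x y hx hy]; first by rewrite tensor_scaleE scale1r.
by rewrite tensor_scale_additive hx hy.
Qed.

Lemma tensor_scaleDr : right_distributive tensor_scale +%R.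
Proof.
move=> r x y; have rB := tensor_scale_additive r.
have rN z : tensor_scale r (- z) = - tensor_scale r z.
  by rewrite -[- z]sub0r -(subrr 0) !rB subrr sub0r.
by rewrite -[y in LHS]opprK rB rN opprK.
Qed.

Lemma tensor_scaleDl x : {morph tensor_scale^~ x : r s / r + s}.
Proof.
move=> r s; move: x; apply: tensor_ind => [u v|x y hx hy].
  by rewrite !tensor_scaleE scalerDl tensDl.
by rewrite !tensor_scale_additive hx hy opprD addrACA.
Qed.

HB.instance Definition _ := GRing.Zmodule_isLmodule.Build R tensor
  tensor_scaleA tensor_scale1 tensor_scaleDr tensor_scaleDl.

Lemma tensZl r u v : tens (r *: u) v = r *: tens u v.
Proof. by rewrite -[RHS]/(tensor_scale _ _) tensor_scaleE. Qed.

Lemma tensZr r u v : tens u (r *: v) = r *: tens u v.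
Proof. by rewrite -tensZC tensZl. Qed.

End Tensor.

Section NearlyFrobenius.
Variables (R : comPzRingType) (A : algebra R).
Local Notation AA := (tensor A A).

Definition tens_mul : AA -> A := tensor_lift (fun x y : A => x * y).

Definition tens_lact (a : A) : AA -> AA :=
  tensor_lift (fun x y : A => tens (a * x) y).

Definition tens_ract (t : AA) (b : A) : AA :=
  tensor_lift (fun x y : A => tens x (y * b)) t.

Lemma tens_mul_additive : zmod_morphism tens_mul.
Proof.
apply: tensor_lift_additive => [u u' v|u v v'|r u v].
- exact: mulrDl.
- exact: mulrDr.
- by rewrite -algebra_scalerAl algebra_scalerAr.
Qed.

Lemma tens_mulE x y : tens_mul (tens x y) = x * y.
Proof.
apply: (tensor_liftE (f := fun x y : A => x * y)) => [u u' v|u v v'|r u v].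
- exact: mulrDl.
- exact: mulrDr.
- by rewrite -algebra_scalerAl algebra_scalerAr.
Qed.

Lemma tens_lact_additive a : zmod_morphism (tens_lact a).
Proof.
apply: tensor_lift_additive => [u u' v|u v v'|r u v].
- by rewrite mulrDr tensDl.
- exact: tensDr.
- by rewrite -algebra_scalerAr tensZC.
Qed.

Lemma tens_lactE a x y : tens_lact a (tens x y) = tens (a * x) y.
Proof.
apply: (tensor_liftE (f := fun x y : A => tens (a * x) y))
  => [u u' v|u v v'|r u v].
- by rewrite mulrDr tensDl.
- exact: tensDr.
- by rewrite -algebra_scalerAr tensZC.
Qed.

Lemma tens_ract_additive b : zmod_morphism (tens_ract^~ b).
Proof.
apply: tensor_lift_additive => [u u' v|u v v'|r u v].
- exact: tensDl.
- by rewrite mulrDl tensDr.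
- by rewrite -algebra_scalerAl tensZC.
Qed.

Lemma tens_ractE x y b : tens_ract (tens x y) b = tens x (y * b).
Proof.
apply: (tensor_liftE (f := fun x y : A => tens x (y * b)))
  => [u u' v|u v v'|r u v].
- exact: tensDl.
- by rewrite mulrDl tensDr.
- by rewrite -algebra_scalerAl tensZC.
Qed.

Definition nearly_frobenius (Delta : A -> AA) : Prop :=
  linear Delta /\
  forall a x b : A, Delta (a * x * b) = tens_ract (tens_lact a (Delta x)) b.

Definition handle_element (Delta : A -> AA) : A := tens_mul (Delta 1).

(* GRing.unit is not available: A carries no unitRingType structure. *)
Definition is_unit (w : A) : Prop := exists v : A, v * w = 1 /\ w * v = 1.

Definition separable_algebra : Prop :=
  exists e : AA, tens_mul e = 1 /\ forall x : A, tens_lact x e = tens_ract e x.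

End NearlyFrobenius.

Arguments separable_algebra {R} A.

(* Main.v *)
(** If [t = Delta 1], the bimodule property gives [x . t = Delta x = t . x], so
the handle element [w = m t] is central, hence so is its inverse [v], and
[v . t] is a separability idempotent. Conversely a separability idempotent [e]
yields [Delta x = x . e], whose handle element is [m e = 1]. *)

Require Import Defs.
From mathcomp Require Import all_boot all_algebra.

Import GRing.Theory.
Local Open Scope ring_scope.

Section TensorBimodule.
Variables (R : comPzRingType) (A : algebra R).
Implicit Types (a b x y : A) (t : tensor A A).

Lemma tens_lact1 t : tens_lact 1 t = t.
Proof.
move: t; apply: tensor_ind => [u v|x y hx hy]; first by rewrite tens_lactE mul1r.
by rewrite tens_lact_additive hx hy.
Qed.

Lemma tens_ract1 t : tens_ract t 1 = t.
Proof.
move: t; apply: tensor_ind => [u v|x y hx hy]; first by rewrite tens_ractE mulr1.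
by rewrite tens_ract_additive hx hy.
Qed.

Lemma tens_lactM a b t : tens_lact (a * b) t = tens_lact a (tens_lact b t).
Proof.
move: t; apply: tensor_ind => [u v|x y hx hy]; first by rewrite !tens_lactE mulrA.
by rewrite !tens_lact_additive hx hy.
Qed.

(** The left action only touches the first tensor factor and the right action only the second. *)
Lemma tens_lact_ract a b t :
  tens_lact a (tens_ract t b) = tens_ract (tens_lact a t) b.
Proof.
move: t; apply: tensor_ind => [u v|x y hx hy].
  by rewrite !(tens_ractE, tens_lactE).
by rewrite tens_ract_additive !tens_lact_additive tens_ract_additive hx hy.
Qed.

(** Needed for the linearity of the map [x |-> x . e] built from a separability idempotent. *)
Lemma tens_lact_linearl t : linear (fun a => tens_lact a t).
Proof.
move=> r a b; move: t; apply: tensor_ind => [u v|x y hx hy].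
  by rewrite !tens_lactE mulrDl tensDl -algebra_scalerAl tensZl.
by rewrite !tens_lact_additive hx hy scalerBr opprD addrACA.
Qed.

Lemma tens_mul_lact a t : tens_mul (tens_lact a t) = a * tens_mul t.
Proof.
move: t; apply: tensor_ind => [u v|x y hx hy].
  by rewrite tens_lactE !tens_mulE mulrA.
by rewrite tens_lact_additive !tens_mul_additive hx hy mulrBr.
Qed.

Lemma tens_mul_ract t b : tens_mul (tens_ract t b) = tens_mul t * b.
Proof.
move: t; apply: tensor_ind => [u v|x y hx hy].
  by rewrite tens_ractE !tens_mulE mulrA.
by rewrite tens_ract_additive !tens_mul_additive hx hy mulrBl.
Qed.

End TensorBimodule.

Theorem theorem3p8 (R : comPzRingType) (A : algebra R) :
  (exists Delta : A -> tensor A A,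
      nearly_frobenius Delta /\ is_unit (handle_element Delta))
  <-> separable_algebra A.
Proof.
split=> [[Delta [[_ DeltaM] [v [vw wv]]]]|[e [me eC]]]; last first.
  exists (fun x => tens_lact x e); split.
    split=> [|a x b]; first exact: tens_lact_linearl.
    (* [a . (x . (b . e)) = a . (x . (e . b)) = (a . (x . e)) . b]. *)
    by rewrite !tens_lactM eC !tens_lact_ract.
  by rewrite /handle_element tens_lact1 me; exists 1; rewrite mulr1.
rewrite /handle_element in vw wv; set t := Delta 1 in vw wv.
(* Both sides equal [Delta x]: read [x] as [x * 1 * 1] and as [1 * 1 * x]. *)
have tC x : tens_lact x t = tens_ract t x.
  have := DeltaM x 1 1; have := DeltaM 1 1 x.
  by rewrite !mulr1 !mul1r tens_lact1 tens_ract1 => -> ->.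
have wC x : x * tens_mul t = tens_mul t * x.
  by rewrite -tens_mul_lact tC tens_mul_ract.
(* With [w = m t] central, [x v = v w x v = v x w v = v x]. *)
have vC x : x * v = v * x.
  by rewrite -[x * v]mul1r -vw -mulrA [tens_mul t * _]mulrA -wC -(mulrA x) wv mulr1.
exists (tens_lact v t); split=> [|x]; first by rewrite tens_mul_lact.
(* Centrality of [v] lets [x] pass it and reach [t]: [x . (v . t) = v . (x . t) = v . (t . x) = (v .
   t) . x]. *)
by rewrite -tens_lactM vC tens_lactM tC tens_lact_ract.
Qed.
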